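(* Let $\mathcal{C}=(\Omega,V)$ be a fractional repetition code with parameters $(n,\theta,\alpha,\rho)$ such that any $\Delta+1$ nodes in $V$ cover all $\theta$ symbols and $|V_i\cap V_j|\le\beta$ for all distinct $V_i,V_j\in V$. Let $l>1$ and let $\bar{\mathcal{C}}$ be the locally recoverable fractional repetition code formed by the disjoint union of $l$ copies of $\mathcal{C}$ (on pairwise disjoint symbol sets), so that $\bar{\mathcal{C}}$ has parameters $(ln,l\theta,\alpha,\rho)$. Suppose that $$(\rho-1)\alpha\theta-(\theta+\alpha)(\Delta-1)\beta\ge 0,$$ and let the file size be $\mathcal{M}=t\theta+\alpha$ for some integer $1\le t<l$. Then $\bar{\mathcal{C}}$ is optimal with respect to the minimum distance bound for disjoint unions of local FR codes, i.e. its minimum distance is $$d_{\min}= ln-\left\lceil\frac{\mathcal{M}\rho}{\alpha}\right\rceil+\rho .$$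
   Context: A fractional repetition (FR) code with parameters $(n,\theta,\alpha,\rho)$ is a pair $(\Omega,V)$ where $\Omega$ is a set of $\theta$ symbols and $V=\{V_1,\dots,V_n\}$ is a collection of $n$ distinct $\alpha$-element subsets of $\Omega$ (the storage nodes) such that each symbol belongs to exactly $\rho$ of the nodes; in particular $n\alpha=\theta\rho$. (An FR code also comes with a repair degree $d$ and a resilience $\rho^{res}\le\rho$ such that whenever $\rho^{res}-1$ nodes fail, each failed node can be exactly rebuilt by downloading $\alpha/d$ of its symbols from each of some $d$ surviving nodes; the integer $\beta$ in the claim is only an upper bound on pairwise intersections.) A set of nodes covers the symbols in the union of its members. In $\bar{\mathcal{C}}$ each copy of $\mathcal{C}$ serves as a local FR code: a failed node is repaired using nodes of its own copy only. A file of $\mathcal{M}$ symbols is encoded by an MDS code of length equal to the total number of symbols and dimension $\mathcal{M}$, and the encoded symbols are placed on the nodes; a set of nodes can recover the file if and only if it covers at least $\mathcal{M}$ distinct symbols. The minimum distance $d_{\min}$ (for file size $\mathcal{M}$) is the smallest size of a set of nodes whose failure makes the file not recoverable from the surviving nodes. The bound in question: if an FR code with $n'$ nodes is partitioned into $\ell$ disjoint local FR codes with parameters $(n_{loc},\theta_{loc},\alpha,\rho_{loc})$ and $\mathcal{M}=t\theta_{loc}+\beta'$ with $1\le t<\ell$ and $0\le\beta'\le\alpha$, then $d_{\min}\le n'-\lceil \mathcal{M}\rho_{loc}/\alpha\rceil+\rho_{loc}$; a code is optimal with respect to it if equality holds. *)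

(* Defs.v *)
From mathcomp Require Import all_boot all_order all_algebra.

Set Implicit Arguments.
Unset Strict Implicit.
Unset Printing Implicit Defensive.

(* A code is a pair (Omega, V) with the symbol set Omega taken inside an ambient
   finite type T, so that a local code and the code containing it can share T.
   As V is a set of sets, its nodes are distinct.  Only positivity of alpha is
   imposed; it is what makes the quotient M * rho / alpha meaningful. *)
Definition is_FR_code (T : finType) (Omega : {set T}) (V : {set {set T}})
    (n theta alpha rho : nat) : Prop :=
  [/\ 0 < alpha, #|Omega| = theta, #|V| = n,
      forall A, A \in V -> A \subset Omega /\ #|A| = alpha
    & forall x, x \in Omega -> #|[set A in V | x \in A]| = rho].

Definition copy (l : nat) (T : finType) (k : 'I_l) (A : {set T}) :
    {set 'I_l * T} := [set (k, x) | x in A].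

Definition copies_symbols (l : nat) (T : finType) (Omega : {set T}) :
    {set 'I_l * T} := \bigcup_(k < l) copy k Omega.

Definition copies_nodes (l : nat) (T : finType) (V : {set {set T}}) :
    {set {set 'I_l * T}} := \bigcup_(k < l) [set copy k A | A in V].

Definition is_union_of_local_FR_codes (T : finType) (Omega : {set T})
    (V : {set {set T}}) (l n_loc theta_loc alpha rho_loc : nat) : Prop :=
  exists (Omegas : 'I_l -> {set T}) (Vs : 'I_l -> {set {set T}}),
  [/\ forall k, is_FR_code (Omegas k) (Vs k) n_loc theta_loc alpha rho_loc,
      forall j k, j != k -> [disjoint Omegas j & Omegas k],
      Omega = \bigcup_(k < l) Omegas k
    & V = \bigcup_(k < l) Vs k].

(* The file is encoded by an MDS code of dimension M, so that any M distinct
   encoded symbols determine it and fewer do not. *)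
Definition recovers (T : finType) (M : nat) (S : {set {set T}}) : bool :=
  M <= #|cover S|.

(* The default V of the minimum is itself an admissible set of failed nodes
   as soon as 0 < M, since then the empty set of survivors recovers nothing. *)
Definition min_distance (T : finType) (V : {set {set T}}) (M : nat) : nat :=
  #|[arg min_(F < V | (F \subset V) && ~~ recovers M (V :\: F)) #|F| ]|.

Definition min_distance_bound (n alpha rho M : nat) : int :=
  (n%:Z - Num.ceil ((M * rho)%N%:Q / alpha%:Q) + rho%:Z)%R.

(* Main.v *)
(* Since n * alpha = theta * rho, the claimed distance is (l - t) * n.  Failing
   all nodes of l - t copies leaves only t * theta symbols, so it remains to see
   that any t * n + 1 nodes cover t * theta + alpha symbols.  By Corradi's bound
   and the hypothesis on beta, a nodes of one copy either cover all of it or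
   cover at least a * (theta + alpha) / (n + 1) symbols.  If s copies are covered
   completely, the other copies hold at least (t - s) * n + 1 of the nodes: for
   s < t these cover (t - s) * theta + alpha symbols because theta <= n * alpha,
   for s = t a single node suffices, and for s > t nothing more is needed. *)
Require Import Defs.
From mathcomp Require Import all_boot all_order all_algebra.
From mathcomp Require Import zify ring.

Set Implicit Arguments.
Unset Strict Implicit.
Unset Printing Implicit Defensive.

Import Order.TTheory GRing.Theory Num.Theory.

(** * Sizes of unions and incidence counts *)

Lemma card_disjoint_bigcup (I U : finType) (F : I -> {set U}) :
  (forall i j, i != j -> [disjoint F i & F j]) ->
  #|\bigcup_i F i| = \sum_i #|F i|.
Proof.
move=> dF; rewrite -sum1_card partition_disjoint_bigcup //.
by apply: eq_bigr => i _; rewrite sum1_card.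
Qed.

(** The number of indices is kept as a sum of ones, so that the indices below or above [t] can be
    counted later as big sums. *)
Lemma leq_card_bigcup (I U : finType) (P : pred I) (F : I -> {set U}) m :
  (forall i, P i -> #|F i| <= m) ->
  #|\bigcup_(i | P i) F i| <= (\sum_(i | P i) 1) * m.
Proof.
move=> le_m; rewrite big_distrl /=.
elim/big_rec2: _ => [|i x A Pi le_Ax]; first by rewrite cards0.
rewrite mul1n; apply: leq_trans (leq_card_setU _ _) _.
by rewrite leq_add ?le_m.
Qed.

Lemma sum_card_incidence (T : finType) (S : {set {set T}}) (D : {set T}) :
  (forall A, A \in S -> A \subset D) ->
  \sum_(A in S) #|A| = \sum_(x in D) #|[set A in S | x \in A]|.
Proof.
move=> SD; under [RHS]eq_bigr => x _ do rewrite -sum1dep_card.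
rewrite (exchange_big_dep (mem S)) /=; last by move=> x A _ /andP[].
apply: eq_bigr => A AS; rewrite -sum1_card; apply: eq_bigl => x.
by rewrite AS /= andb_idl // => /(subsetP (SD A AS)).
Qed.

(** The squared degree of [x] counts the ordered pairs of members that both contain [x]; exchanging
    the sums counts the common symbols of each pair instead. *)
Lemma sum_sqr_degree (T : finType) (S : {set {set T}}) :
  \sum_(x in cover S) #|[set A in S | x \in A]| ^ 2
  = \sum_(A in S) \sum_(B in S) #|A :&: B|.
Proof.
transitivity (\sum_(x in cover S) \sum_(A in S | x \in A)
    \sum_(B in S | x \in B) 1).
  by apply: eq_bigr => x _; rewrite !sum1dep_card sum_nat_cond_const mulnn.
rewrite (exchange_big_dep (mem S)) /=; last by move=> x A _ /andP[].
apply: eq_bigr => A AS; rewrite (exchange_big_dep (mem S)) /=; last first.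
  by move=> x B _ /andP[].
apply: eq_bigr => B BS; rewrite -sum1_card; apply: eq_bigl => x.
rewrite AS BS inE /= -andbA andb_idl // => /andP[xA _].
by apply/bigcupP; exists A.
Qed.

(** * Cauchy-Schwarz and Corradi's bound *)

Lemma sqr_sum_le (I : finType) (D : {set I}) (d : I -> nat) :
  (\sum_(i in D) d i) ^ 2 <= #|D| * \sum_(i in D) d i ^ 2.
Proof.
set m := \sum_(i in D) d i; set q := \sum_(i in D) d i ^ 2.
have [D0|D0] := posnP #|D|.
  by rewrite /m (cards0_eq D0) big_set0.
(* The defect of the inequality, scaled by [#|D|], is the sum of the squares of [#|D| * d i - m];
   integers allow these differences to be negative. *)
suff: (0 <= #|D|%:Z * (#|D|%:Z * q%:Z - m%:Z ^+ 2))%R by nia.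
have -> : (#|D|%:Z * (#|D|%:Z * q%:Z - m%:Z ^+ 2)
   = \sum_(i in D) (#|D|%:Z * (d i)%:Z - m%:Z) ^+ 2)%R; last first.
  by apply: sumr_ge0 => i _; apply: sqr_ge0.
have qE : (q%:Z = \sum_(i in D) (d i)%:Z ^+ 2)%R.
  by rewrite /q (big_morph Posz PoszD (erefl _)); apply: eq_bigr => i _; lia.
have mE : (m%:Z = \sum_(i in D) (d i)%:Z)%R.
  by rewrite /m (big_morph Posz PoszD (erefl _)).
rewrite (eq_bigr (fun i => #|D|%:Z ^+ 2 * (d i)%:Z ^+ 2
  - 2 * #|D|%:Z * m%:Z * (d i)%:Z + m%:Z ^+ 2)%R); last by move=> i _; ring.
rewrite big_split sumrB /= -!mulr_sumr -qE -mE sumr_const -mulr_natl natz; ring.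
Qed.

(* Corradi's bound: Cauchy-Schwarz applied to the degrees of the covered
   symbols. *)
Lemma cover_lower_bound (T : finType) (S : {set {set T}}) (alpha : nat)
    (beta : int) :
  (forall A, A \in S -> #|A| = alpha) ->
  (forall A B, A \in S -> B \in S -> A != B -> (#|A :&: B|%:Z <= beta)%R) ->
  ((#|S|%:Z * alpha%:Z) ^+ 2
   <= #|cover S|%:Z * (#|S|%:Z * (alpha%:Z + (#|S|%:Z - 1) * beta)))%R.
Proof.
move=> Sa Sb.
have sub A : A \in S -> A \subset cover S by move=> AS; apply: bigcup_sup.
have m : \sum_(x in cover S) #|[set A in S | x \in A]| = #|S| * alpha.
  by rewrite -sum_card_incidence // (eq_bigr _ Sa) sum_nat_const.
have := sqr_sum_le (cover S) (fun x => #|[set A in S | x \in A]|).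
rewrite m sum_sqr_degree -lez_nat => le_sq.
apply: (le_trans (y := (#|cover S| *
  \sum_(A in S) \sum_(B in S) #|A :&: B|)%:Z)%R); first by lia.
rewrite PoszM ler_wpM2l //.
rewrite (big_morph Posz PoszD (erefl _)).
have -> : (#|S|%:Z * (alpha%:Z + (#|S|%:Z - 1) * beta)
  = \sum_(A in S) (alpha%:Z + (#|S|%:Z - 1) * beta))%R.
  by rewrite sumr_const -mulr_natl natz.
apply: ler_sum => A AS.
(* The diagonal pair contributes [alpha]; each of the other [#|S| - 1] pairs contributes at most
   [beta]. *)
rewrite (bigD1 A) //= setIid Sa // PoszD lerD2l.
rewrite (big_morph Posz PoszD (erefl _)).
have -> : ((#|S|%:Z - 1) * beta = \sum_(B in S :\ A) beta)%R.
  rewrite sumr_const -[RHS]mulr_natl natz (cardsD1 A S) AS PoszD /=.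
  by rewrite addrC addKr.
rewrite [leRHS](eq_bigl (fun B => (B \in S) && (B != A))); last first.
  by move=> B; rewrite !inE andbC.
by apply: ler_sum => B /andP[BS BA]; apply: Sb => //; rewrite eq_sym.
Qed.

(** * Coverage inside one local code *)

Lemma FR_code_count (T : finType) (Omega : {set T}) (V : {set {set T}})
    (n theta alpha rho : nat) :
  is_FR_code Omega V n theta alpha rho -> n * alpha = theta * rho.
Proof.
case=> _ <- <- node deg.
rewrite -!sum_nat_const -(eq_bigr _ deg) -sum_card_incidence.
  by apply: eq_bigr => A /node[].
by move=> A /node[].
Qed.

(* A family that misses a symbol has at most Delta members, so Corradi's bound
   applies with (#|S| - 1) * beta <= (rho - 1) * alpha * theta / (theta + alpha)
   and simplifies by n * alpha = theta * rho. *)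
Lemma cover_full_or_large (T : finType) (Omega : {set T}) (V : {set {set T}})
    (n theta alpha rho Delta : nat) (beta : int) :
  is_FR_code Omega V n theta alpha rho ->
  (forall S : {set {set T}}, S \subset V -> #|S| = Delta.+1 ->
     cover S = Omega) ->
  (forall A B : {set T}, A \in V -> B \in V -> A != B ->
     (#|A :&: B|%:Z <= beta)%R) ->
  (0 <= (rho%:Z - 1) * alpha%:Z * theta%:Z
          - (theta%:Z + alpha%:Z) * (Delta%:Z - 1) * beta)%R ->
  forall S : {set {set T}}, S \subset V ->
    cover S = Omega \/ #|S| * (theta + alpha) <= #|cover S| * n.+1.
Proof.
move=> HC Hcover Hbeta Hineq S SV; have count := FR_code_count HC.
have [alpha_gt0 cardO cardV node deg] := HC.
have [leSD|ltDS] := leqP #|S| Delta; last first.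
  left; apply/eqP; rewrite eqEsubset; apply/andP; split.
    by apply/bigcupsP => A /(subsetP SV)/node[].
  have [s [s_uniq s_size sS]] := card_geqP ltDS.
  rewrite -(Hcover [set:: s]); last 1 first.
  - by rewrite cardsE (card_uniqP s_uniq).
  - by apply/bigcupsP => A; rewrite inE => /sS AS; apply: bigcup_sup.
  by apply/subsetP => A; rewrite inE => /sS /(subsetP SV).
right; have [->|S_gt0] := posnP #|S|; first by rewrite mul0n.
have corradi := @cover_lower_bound _ S alpha beta
  (fun A AS => (node A (subsetP SV A AS)).2)
  (fun A B AS BS => Hbeta A B (subsetP SV A AS) (subsetP SV B BS)).
have n_gt0 : 0 < n by rewrite -cardV; apply: leq_trans (subset_leq_card SV).
have rho_gt0 : 0 < rho by case: (rho) count => //; nia.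
have small : ((#|S|%:Z - 1) * beta * (theta%:Z + alpha%:Z)
    <= (rho%:Z - 1) * alpha%:Z * theta%:Z)%R.
  (* Replacing [#|S| - 1] by [Delta - 1] needs [beta >= 0], which two distinct members provide; with
     a single member the left side vanishes. *)
  have [S_le1|S_gt1] := leqP #|S| 1.
    have -> : #|S| = 1 by lia.
    nia.
  have beta_ge0 : (0 <= beta)%R.
    have [A [B [AS BS AB]]] := card_gt1P S_gt1.
    by apply: le_trans (Hbeta A B _ _ AB); rewrite ?(subsetP SV).
  nia.
move: corradi small; set a := #|S|; set u := #|cover S| => corradi small.
(* The goal is scaled by [a * alpha ^ 2], which turns its left side into that of Corradi's bound
   times [theta + alpha]. *)
have : (a%:Z * alpha%:Z ^+ 2 * (a%:Z * (theta%:Z + alpha%:Z))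
   <= a%:Z * alpha%:Z ^+ 2 * (u%:Z * n.+1%:Z))%R.
  have -> : (a%:Z * alpha%:Z ^+ 2 * (a%:Z * (theta%:Z + alpha%:Z))
     = (a%:Z * alpha%:Z) ^+ 2 * (theta%:Z + alpha%:Z))%R by ring.
  apply: le_trans (ler_wpM2r _ corradi) _; first by lia.
  (* Since [theta * rho = n * alpha], the last factor on the right equals [alpha ^ 2 * (n + 1)];
     this is the source of [n.+1]. *)
  have -> : (a%:Z * alpha%:Z ^+ 2 * (u%:Z * n.+1%:Z) = u%:Z * a%:Z *
     (alpha%:Z * (theta%:Z + alpha%:Z) + (rho%:Z - 1) * alpha%:Z * theta%:Z))%R.
    have : (n%:Z * alpha%:Z = theta%:Z * rho%:Z)%R by lia.
    rewrite -[n.+1]addn1 PoszD => count_int; ring: count_int.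
  rewrite -!mulrA !ler_wpM2l //; lia.
rewrite ler_pM2l; first by lia.
by rewrite mulr_gt0 ?exprn_gt0.
Qed.

(** * Disjoint unions of local codes *)

Section DisjointUnion.

Variables (T : finType) (l : nat).
Variables (Omegas : 'I_l -> {set T}) (Vs : 'I_l -> {set {set T}}).
Variables (n theta alpha rho : nat).
Hypothesis FR_local : forall k, is_FR_code (Omegas k) (Vs k) n theta alpha rho.
Hypothesis disj : forall j k, j != k -> [disjoint Omegas j & Omegas k].

(** An index is required because [FR_local] gives no information when [l = 0]. *)
Let alpha_gt0 (k : 'I_l) : 0 < alpha.
Proof. by case: (FR_local k). Qed.

Lemma local_node_sub k A : A \in Vs k -> A \subset Omegas k.
Proof. by case: (FR_local k) => _ _ _ node _ /node[]. Qed.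

Lemma local_node_card k A : A \in Vs k -> #|A| = alpha.
Proof. by case: (FR_local k) => _ _ _ node _ /node[]. Qed.

(** A shared node would be nonempty, as [alpha > 0], and would lie in two disjoint symbol sets. *)
Lemma local_nodes_disjoint j k : j != k -> [disjoint Vs j & Vs k].
Proof.
move=> jk; apply/pred0P => A; apply/negbTE/negP => /andP[/= Aj Ak].
have := alpha_gt0 j; rewrite -(local_node_card Aj) => /card_gt0P[x xA].
have /pred0P/(_ x)/negbT/negP[] := disj jk.
by rewrite /= (subsetP (local_node_sub Aj)) ?(subsetP (local_node_sub Ak)).
Qed.

Lemma FR_code_union (l_gt0 : 0 < l) :
  is_FR_code (\bigcup_k Omegas k) (\bigcup_k Vs k) (l * n) (l * theta) alpha rho.
Proof.
split.
- exact: alpha_gt0 (Ordinal l_gt0).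
- rewrite card_disjoint_bigcup // (eq_bigr (fun=> theta)).
    by rewrite sum_nat_const card_ord.
  by move=> k _; case: (FR_local k).
- rewrite (card_disjoint_bigcup local_nodes_disjoint) (eq_bigr (fun=> n)).
    by rewrite sum_nat_const card_ord.
  by move=> k _; case: (FR_local k).
- move=> A /bigcupP[k _ Ak]; split; last exact: local_node_card Ak.
  exact: subset_trans (local_node_sub Ak) (bigcup_sup k isT).
move=> x /bigcupP[k _ xk]; have [_ _ _ _ /(_ x xk) <-] := FR_local k.
apply: eq_card => A; rewrite !inE; apply: andb_id2r => xA.
(* The union does not raise the degree of [x]: a node through [x] can only come from the copy that
   owns [x]. *)
apply/bigcupP/idP => [[j _ Aj]|]; last by exists k.
have [<- //|jk] := eqVneq j k.
have /pred0P/(_ x)/negbT/negP[] := disj jk.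
by rewrite /= xk (subsetP (local_node_sub Aj)).
Qed.

Lemma card_slices (S : {set {set T}}) :
  S \subset \bigcup_k Vs k -> #|S| = \sum_k #|S :&: Vs k|.
Proof.
move=> /setIidPl {1}<-; rewrite big_distrr /=.
apply: card_disjoint_bigcup => i j ij.
exact: disjointW (subsetIr _ _) (subsetIr _ _) (local_nodes_disjoint ij).
Qed.

Lemma card_cover_slices (S : {set {set T}}) :
  S \subset \bigcup_k Vs k -> #|cover S| = \sum_k #|cover (S :&: Vs k)|.
Proof.
move=> SV; rewrite -card_disjoint_bigcup => [|i j ij].
  apply: eq_card => x; apply/bigcupP/bigcupP => [[A AS xA]|[k _]].
    have /bigcupP[k _ Ak] := subsetP SV A AS; exists k => //.
    by apply/bigcupP; exists A; rewrite // inE AS.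
  by case/bigcupP => A /setIP[AS _] xA; exists A.
by apply: disjointW (disj ij); apply/bigcupsP => A /setIP[_ /local_node_sub].
Qed.

(** The second alternative is linear in both cardinalities, so it can be summed over all copies that
    are not fully covered. *)
Lemma cover_many_nodes (t : nat) :
  (forall k (S : {set {set T}}), S \subset Vs k ->
     cover S = Omegas k \/ #|S| * (theta + alpha) <= #|cover S| * n.+1) ->
  forall S : {set {set T}}, S \subset \bigcup_k Vs k ->
    t * n < #|S| -> t * theta + alpha <= #|cover S|.
Proof.
move=> local S SV ltS.
have [A0 A0S] : exists A, A \in S by apply/card_gt0P; apply: leq_trans ltS.
have /bigcupP[k0 _ A0k] := subsetP SV A0 A0S.
have [alpha_pos cardO cardV _ _] := FR_local k0.
have count := FR_code_count (FR_local k0).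
have le_alpha : alpha <= theta.
  by rewrite -cardO -(local_node_card A0k) subset_leq_card ?local_node_sub.
have n_gt0 : 0 < n by rewrite -cardV; apply/card_gt0P; exists A0.
(* Here [rho] is nonzero because [n * alpha] is positive, so [theta <= theta * rho]. *)
have le_theta : theta <= n * alpha by case: (rho) count => [|r]; nia.
pose full := [pred k | cover (S :&: Vs k) == Omegas k].
have cardS := card_slices SV; have cardC := card_cover_slices SV.
rewrite (bigID full) /= in cardS; rewrite (bigID full) /= in cardC.
have le_full : \sum_(k | full k) #|S :&: Vs k| <= #|full| * n.
  rewrite -sum_nat_const leq_sum // => k _.
  by case: (FR_local k) => _ _ <- _ _; apply: subset_leq_card (subsetIr _ _).
have eq_full : \sum_(k | full k) #|cover (S :&: Vs k)| = #|full| * theta.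
  rewrite -sum_nat_const; apply: eq_bigr => k /eqP ->.
  by case: (FR_local k).
(* [x] counts the nodes of [S] in the copies that are not full, and [y] the symbols they cover
   there. *)
move: cardS cardC; set x := \sum_(k | ~~ _) _; set y := \sum_(k | ~~ _) _.
move=> cardS cardC.
have le_xy : x * (theta + alpha) <= y * n.+1.
  rewrite !big_distrl leq_sum //= => k notfull.
  have [covk|//] := local k _ (subsetIr S (Vs k)).
  by rewrite covk eqxx in notfull.
have le_y : 0 < x -> alpha <= y.
  rewrite lt0n sum_nat_eq0 negb_forall => /existsP[k].
  rewrite negb_imply => /andP[notfull]; rewrite -lt0n => /card_gt0P[A Ak].
  rewrite /y (bigD1 k) //=; apply: leq_trans (leq_addr _ _).
  have /setIP[_ /local_node_card <-] := Ak.
  by apply/subset_leq_card/bigcup_sup.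
rewrite cardC; move: cardS ltS le_full; rewrite eq_full.
set z := \sum_(k | _) _; move=> -> ltS le_full.
(* With more than [t] full copies, the extra one contributes [theta >= alpha] symbols. *)
have [lt_t|lt_t|eq_t] := ltngtP t #|full|; first nia.
  have [m t_eq] : exists m, t = #|full| + m.+1.
    by exists (t - #|full|).-1; lia.
  rewrite t_eq in ltS *; set s := #|full| in ltS le_full *.
  have lt_x : m.+1 * n < x by nia.
  (* The right side exceeds the left by [m * (n * alpha - theta)], which is nonnegative by
     [le_theta]. *)
  have le_m : n.+1 * (m.+1 * theta + alpha) <= (m.+1 * n).+1 * (theta + alpha).
    by nia.
  have : n.+1 * (m.+1 * theta + alpha) <= n.+1 * y.
    rewrite [leqRHS]mulnC (leq_trans le_m) // (leq_trans _ le_xy) //.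
    by rewrite leq_mul2r lt_x orbT.
  by rewrite leq_pmul2l //; lia.
rewrite -eq_t leq_add2l; apply: le_y; nia.
Qed.

Lemma few_nodes_cover (t : nat) : t <= l ->
  exists F : {set {set T}}, [/\ F \subset \bigcup_k Vs k, #|F| <= (l - t) * n
    & #|cover ((\bigcup_k Vs k) :\: F)| <= t * theta].
Proof.
(* The failed nodes are those of the copies with index at least [t]. *)
move=> le_tl; exists (\bigcup_(k < l | t <= k) Vs k); split.
- by apply/bigcupsP => k _; apply: bigcup_sup.
- have -> : l - t = \sum_(k < l | t <= k) 1.
    by rewrite -(big_geq_mkord _ _ xpredT (fun=> 1)) sum_nat_const_nat muln1.
  apply: leq_card_bigcup => k _.
  by case: (FR_local k) => _ _ ->.
have -> : t * theta = (\sum_(k < l | k < t) 1) * theta.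
  by rewrite (big_ord_narrow le_tl) sum_nat_const card_ord muln1.
apply: leq_trans (_ : #|\bigcup_(k < l | k < t) Omegas k| <= _).
  apply/subset_leq_card/bigcupsP => A /setDP[/bigcupP[k _ Ak]].
  have [le_tk|lt_kt] := leqP t k.
    by case/negP; apply/bigcupP; exists k.
  by move=> _; apply: subset_trans (local_node_sub Ak) (bigcup_sup k lt_kt).
apply: leq_card_bigcup => k _.
by case: (FR_local k) => _ ->.
Qed.

Lemma min_distance_union (t : nat) : 0 < l -> t <= l ->
  (forall k (S : {set {set T}}), S \subset Vs k ->
     cover S = Omegas k \/ #|S| * (theta + alpha) <= #|cover S| * n.+1) ->
  min_distance (\bigcup_k Vs k) (t * theta + alpha) = (l - t) * n.
Proof.
move=> l_gt0 le_tl local; rewrite /min_distance /recovers.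
have a_gt0 := alpha_gt0 (Ordinal l_gt0).
have [_ _ cardV _ _] := FR_code_union l_gt0.
case: arg_minnP => [|F /andP[FV]].
  by rewrite subxx setDv /cover big_set0 cards0 -ltnNge; lia.
rewrite -ltnNge => lost F_min; apply/eqP; rewrite eqn_leq; apply/andP; split.
  have [F' [F'V F'le F'lost]] := few_nodes_cover le_tl.
  by apply: leq_trans (F_min F' _) F'le; rewrite F'V -ltnNge; lia.
(* Contrapositive: fewer than [(l - t) * n] failures leave more than [t * n] survivors. *)
rewrite leqNgt; apply: contraL lost => lt_F; rewrite -leqNgt.
apply: cover_many_nodes => //; first exact: subsetDl.
rewrite cardsD (setIidPr FV) cardV; move: lt_F; rewrite mulnBl; lia.
Qed.

End DisjointUnion.

(** * Transport of a local code along an injection *)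

Section InjectiveImage.

Variables (T U : finType) (f : T -> U).
Hypothesis f_inj : injective f.

Let imset_f_inj : injective (fun A : {set T} => f @: A) := imset_inj f_inj.

Lemma FR_code_imset (Omega : {set T}) (V : {set {set T}})
    (n theta alpha rho : nat) :
  is_FR_code Omega V n theta alpha rho ->
  is_FR_code (f @: Omega) [set f @: (A : {set T}) | A in V] n theta alpha rho.
Proof.
case=> alpha_gt0 cardO cardV node deg; split => //.
- by rewrite card_imset.
- by rewrite card_imset.
- by move=> _ /imsetP[A /node[AO <-] ->]; rewrite imsetS // card_imset.
move=> _ /imsetP[x /deg <- ->].
rewrite -(card_imset _ imset_f_inj); apply: eq_card => B.
apply/setIdP/imsetP => [[/imsetP[A AV ->]]|[A /setIdP[AV xA] ->]].
  by rewrite mem_imset // => xA; exists A; rewrite // inE AV.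
by rewrite mem_imset // xA imset_f.
Qed.

(** Each family of image nodes is the image of a family in [V], and injectivity preserves both the
    number of nodes and the size of the cover. *)
Lemma cover_full_or_large_imset (Omega : {set T}) (V : {set {set T}})
    (c d : nat) :
  (forall S : {set {set T}}, S \subset V ->
     cover S = Omega \/ #|S| * c <= #|cover S| * d) ->
  forall S : {set {set U}}, S \subset [set f @: (A : {set T}) | A in V] ->
    cover S = f @: Omega \/ #|S| * c <= #|cover S| * d.
Proof.
move=> local S SV.
pose S' := [set A in V | f @: A \in S].
have -> : S = [set f @: (A : {set T}) | A in S'].
  apply/setP => B; apply/idP/imsetP => [BS|[A /setIdP[_ AS] -> //]].
  have /imsetP[A AV B_eq] := subsetP SV B BS.
  by exists A; rewrite // inE AV -B_eq.
rewrite cover_imset -imset_cover !card_imset //.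
have S'V : S' \subset V by apply/subsetP => A /setIdP[].
by have [->|le_S'] := local S' S'V; [left|right].
Qed.

End InjectiveImage.

(** * Value of the bound and optimality *)

Lemma min_distance_boundE (n' n theta alpha rho t : nat) :
  0 < alpha -> n * alpha = theta * rho ->
  min_distance_bound n' alpha rho (t * theta + alpha)
  = (n'%:Z - (t * n)%N%:Z)%R.
Proof.
move=> alpha_gt0 count; rewrite /min_distance_bound.
(* By [count] the quotient by [alpha] is the integer [t * n + rho], so the ceiling has no effect and
   [rho] cancels. *)
have -> : (t * theta + alpha) * rho = (t * n + rho) * alpha by nia.
rewrite PoszM intrM mulfK; first by rewrite intrKceil PoszD; ring.
by rewrite intr_eq0 -lt0n.
Qed.

Theorem lemma5 (T : finType) (Omega : {set T}) (V : {set {set T}})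
    (n theta alpha rho Delta : nat) (beta : int) (l t M : nat)
    (HC : is_FR_code Omega V n theta alpha rho)
    (Hcover : forall S : {set {set T}},
        S \subset V -> #|S| = Delta.+1 -> cover S = Omega)
    (Hbeta : forall A B : {set T},
        A \in V -> B \in V -> A != B -> (#|A :&: B|%:Z <= beta)%R)
    (Hl : 1 < l)
    (Hineq : (0 <= (rho%:Z - 1) * alpha%:Z * theta%:Z
                   - (theta%:Z + alpha%:Z) * (Delta%:Z - 1) * beta)%R)
    (Ht : 1 <= t < l)
    (HM : M = t * theta + alpha) :
  [/\ is_FR_code (copies_symbols l Omega) (copies_nodes l V)
        (l * n) (l * theta) alpha rho,
      is_union_of_local_FR_codes (copies_symbols l Omega) (copies_nodes l V)
        l n theta alpha rho
    & Posz (min_distance (copies_nodes l V) M)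
      = min_distance_bound (l * n) alpha rho M].
Proof.
have l_gt0 := ltnW Hl; have /andP[_ /ltnW le_tl] := Ht.
have pair_inj (k : 'I_l) : injective (pair k : T -> 'I_l * T) by move=> x y [].
(* [copy k] is by definition the image under [pair k], so the transport lemmas apply to it. *)
have FR_copy (k : 'I_l) := FR_code_imset (pair_inj k) HC.
have disj (j k : 'I_l) : j != k -> [disjoint copy j Omega & copy k Omega].
  move=> jk; apply/pred0P => x; apply/negbTE/negP => /andP[/=].
  by case/imsetP => y _ -> /imsetP[z _ [/eqP]]; rewrite (negbTE jk).
split; first exact: FR_code_union.
  by exists (fun k => copy k Omega), (fun k => [set copy k A | A in V]).
have alpha_gt0 : 0 < alpha by case: HC.
rewrite HM (min_distance_boundE _ _ alpha_gt0 (FR_code_count HC)).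
rewrite (min_distance_union FR_copy disj) //.
  (* Truncated subtraction agrees with integer subtraction here because [t <= l]. *)
  by rewrite mulnBl subzn // leq_mul2r le_tl orbT.
move=> k; apply: (cover_full_or_large_imset (pair_inj k)).
exact: (cover_full_or_large HC Hcover Hbeta Hineq).
Qed.
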